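(* Let $m\ge 2$, $n\ge 1$ be two integers. Suppose that $\mathcal{A}$ is a symmetric $m$th order $n$-dimensional tensor with entries in $\{0,1\}$ which has no zero blocks, and let $\mathcal{P}=(V,E)$ be its associated multi-hypergraph. Then the following are equivalent: (1) $\mathcal{A}$ is a $\{0,1\}$-CP tensor. (2) $\mathcal{P}$ can be decomposed as the union of some complete blocks $\mathcal{P}_i$ of size $n_i$ ($i=1,\ldots,q$), where $n_1,\ldots,n_q$ are positive integers with $n_1+\cdots+n_q=n$. (3) $\mathcal{A}$ can be written in the form $\mathcal{A}=\sum_{j=1}^q\mathbf{u}_j^m$ with $\mathbf{u}_j\in\{0,1\}^n$ satisfying $U^\top U=\mathrm{diag}(n_1,\ldots,n_q)$, where $U=[\mathbf{u}_1,\ldots,\mathbf{u}_q]$ and $n_1,\ldots,n_q$ are positive integers with $n_1+\cdots+n_q=n$.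
   Context: An $m$th order $n$-dimensional tensor $\mathcal{A}=(A_{i_1\ldots i_m})$ is an array indexed by $\{1,\ldots,n\}^m$; it is symmetric if its entries are invariant under every permutation of the subscripts. For a nonempty subset $\mathcal{I}\subseteq\{1,\ldots,n\}$, the principal subtensor $\mathcal{A}[\mathcal{I}]$ is obtained by restricting all indices to $\mathcal{I}$; a zero block of $\mathcal{A}$ is a principal subtensor all of whose entries are zero. For $\beta=(b_1,\ldots,b_n)^\top$, $\beta^m$ denotes the tensor with entries $b_{i_1}\cdots b_{i_m}$. $\mathcal{A}$ is $\{0,1\}$-CP if $\mathcal{A}=\sum_{j=1}^K\beta_j^m$ for some $K$ and some $\beta_1,\ldots,\beta_K\in\{0,1\}^n$. The multi-hypergraph $\mathcal{P}=(V,E)$ associated with a symmetric $(0,1)$ tensor $\mathcal{A}$ has vertex set $V=\{1,\ldots,n\}$ and edge set $E$ consisting of those $m$-multisets $\{i_1,\ldots,i_m\}$ of elements of $V$ (repetitions allowed) with $A_{i_1\ldots i_m}=1$. A complete block of size $n_i$ is a multi-hypergraph $(V_i,E_i)$ with $|V_i|=n_i$ in which $E_i$ consists of all $m$-multisets of elements of $V_i$. $\mathcal{P}$ is the union of $\mathcal{P}_i=(V_i,E_i)$, $i=1,\ldots,q$, if $V=\bigcup_iV_i$ and $E=\bigcup_iE_i$. *)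

(* Defs.v *)
From mathcomp Require Import all_boot all_order all_fingroup all_algebra.
From mathcomp Require Import finmap multiset.

Set Implicit Arguments.
Unset Strict Implicit.
Unset Printing Implicit Defensive.

Import GRing.Theory.
Local Open Scope ring_scope.

Notation tensor R m n := {ffun m.-tuple 'I_n -> R}.

Definition symmetric_tensor (R : Type) (m n : nat) (A : tensor R m n) : Prop :=
  forall (s : 'S_m) (i : m.-tuple 'I_n),
    A [tuple tnth i (s k) | k < m] = A i.

Definition zero_one (R : nzRingType) (x : R) : bool := (x == 0) || (x == 1).

Definition zero_one_tensor (R : nzRingType) (m n : nat) (A : tensor R m n) : Prop :=
  forall i : m.-tuple 'I_n, zero_one (A i).

Definition zero_one_vector (R : nzRingType) (n : nat) (b : 'cV[R]_n) : Prop :=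
  forall i : 'I_n, zero_one (b i 0).

(* A[I], reindexed along the increasing enumeration of I. *)
Definition principal_subtensor (R : Type) (m n : nat) (A : tensor R m n)
    (I : {set 'I_n}) : tensor R m #|I| :=
  [ffun i : m.-tuple 'I_#|I| => A [tuple enum_val (tnth i k) | k < m]].

Definition no_zero_block (R : nmodType) (m n : nat) (A : tensor R m n) : Prop :=
  forall I : {set 'I_n}, I != set0 -> principal_subtensor A I <> 0.

Definition tensor_power (R : nzRingType) (m n : nat) (b : 'cV[R]_n) :
    tensor R m n :=
  [ffun i : m.-tuple 'I_n => \prod_(k < m) b (tnth i k) 0].

Definition zero_one_CP (R : nzRingType) (m n : nat) (A : tensor R m n) : Prop :=
  exists (K : nat) (b : 'I_K -> 'cV[R]_n),
    (forall j, zero_one_vector (b j)) /\ A = \sum_(j < K) tensor_power m (b j).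

(* Vertices are taken in a fixed ambient 'I_n, so that the blocks (V_i, E_i)
   and their union live in the same type. *)
Record multihypergraph (n : nat) := MultiHypergraph {
  vertices : {set 'I_n};
  edges : {pred {mset 'I_n}%mset}
}.

(* For a symmetric A, the value A i depends only on the multiset of the entries
   of i; any such multiset has m elements. *)
Definition associated_multihypergraph (R : nzRingType) (m n : nat)
    (A : tensor R m n) : multihypergraph n :=
  {| vertices := [set: 'I_n];
     edges := [pred e : {mset 'I_n}%mset |
       [exists i : m.-tuple 'I_n, (seq_mset i == e) && (A i == 1)]] |}.

Definition complete_block (m n : nat) (H : multihypergraph n) (k : nat) : Prop :=
  #|vertices H| = k /\
  forall e : {mset 'I_n}%mset,
    (e \in edges H) = (size e == m) && all (mem (vertices H)) e.

Definition is_union (n q : nat) (P : multihypergraph n)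
    (H : 'I_q -> multihypergraph n) : Prop :=
  vertices P = \bigcup_(i < q) vertices (H i) /\
  forall e : {mset 'I_n}%mset, (e \in edges P) = [exists i, e \in edges (H i)].

Definition matrix_of_columns (R : Type) (n q : nat) (u : 'I_q -> 'cV[R]_n) :
    'M[R]_(n, q) :=
  \matrix_(i, j) u j i 0.

(* Main.v *)
Require Import Defs.
From mathcomp Require Import all_boot all_order all_fingroup all_algebra.
From mathcomp Require Import finmap multiset.

Set Implicit Arguments.
Unset Strict Implicit.
Unset Printing Implicit Defensive.

Import GRing.Theory Num.Theory.
Local Open Scope ring_scope.

(** The three conditions all say that the index set is partitioned into
    nonempty classes and that an entry of the tensor is 1 exactly when all its
    subscripts lie in one class. This common form is [partition_tensor], and
    each condition is compared with it.

    From a sum of powers of 0/1 vectors to a partition ([CP_partition]): such a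
    vector is the indicator of its support, and the m-th power of an indicator
    of [V] has entry 1 exactly where all subscripts lie in [V]. Hence the
    diagonal entry at [i] counts the supports that contain [i]. That count is an
    entry of the tensor, so it is 0 or 1, and it is not 0 because a vanishing
    diagonal entry is a zero block of size one. So every index lies in exactly
    one support, and the nonempty supports are the classes.

    From a partition to orthogonal columns ([partition_orthogonal]): take the
    indicators of the classes; the Gram matrix of indicators records the sizes
    of the pairwise intersections, so it is diagonal with the class sizes on
    the diagonal. An orthogonal decomposition is in turn a special case of a sum
    of powers of 0/1 vectors, which closes the circle for (1) and (3).

    Between partitions and unions of complete blocks: the edges of the
    hypergraph of a partition tensor are by construction those of the complete
    blocks on the classes ([partition_complete_blocks]). Conversely
    ([complete_blocks_partition]), blocks that cover the n vertices and whose
    sizes add up to n have no room to overlap, so their vertex sets are the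
    classes of a partition ([cover_fibers]); by symmetry the tensor can be read
    back from its edges. *)

(** * Indicator vectors and their tensor powers *)

Definition indicator (R : nzRingType) (n : nat) (V : {set 'I_n}) : 'cV[R]_n :=
  \col_i (i \in V)%:R.

Lemma zero_oneE (R : nzRingType) (x : R) : zero_one x -> x = (x == 1)%:R.
Proof.
by rewrite /zero_one; have [->|_] := eqVneq x 1; rewrite ?orbF // => /eqP.
Qed.

Lemma zero_one_indicator (R : nzRingType) n (V : {set 'I_n}) :
  zero_one_vector (indicator R V).
Proof.
by move=> i; rewrite mxE /zero_one; case: (i \in V); rewrite eqxx ?orbT.
Qed.

Lemma zero_one_vectorE (R : nzRingType) n (b : 'cV[R]_n) :
  zero_one_vector b -> b = indicator R [set i | b i 0 == 1].
Proof.
move=> h; apply/colP => i; rewrite mxE inE.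
exact: zero_oneE.
Qed.

Lemma prod_natr_all (R : nzRingType) (T : Type) (P : pred T) (s : seq T) :
  \prod_(x <- s) (P x)%:R = (all P s)%:R :> R.
Proof.
elim: s => [|x s IHs]; rewrite ?big_nil // big_cons IHs /=.
by case: (P x); rewrite ?mul1r ?mul0r.
Qed.

Lemma tensor_power_indicator (R : nzRingType) m n (V : {set 'I_n})
    (t : m.-tuple 'I_n) :
  tensor_power m (indicator R V) t = (all (mem V) t)%:R.
Proof.
rewrite ffunE -prod_natr_all big_tuple.
by apply: eq_bigr => k _; rewrite mxE.
Qed.

Lemma sum_natr_card (R : nzRingType) (T : finType) (P : pred T) :
  \sum_x (P x)%:R = #|P|%:R :> R.
Proof.
rewrite -sum1_card natr_sum [RHS]big_mkcond; apply: eq_bigr => x _.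
by rewrite unfold_in; case: (P x).
Qed.

(** The product of two indicators is the indicator of the intersection, so
    orthogonality of indicator columns is disjointness of the sets. *)
Lemma indicator_gram (R : nzRingType) n q (V : 'I_q -> {set 'I_n}) :
  (matrix_of_columns (fun j => indicator R (V j)))^T
    *m matrix_of_columns (fun j => indicator R (V j))
  = \matrix_(j, k) #|V j :&: V k|%:R.
Proof.
apply/matrixP => j k; rewrite !mxE.
have -> : #|V j :&: V k| = #|[pred i | i \in V j :&: V k]| by apply: eq_card.
rewrite -sum_natr_card; apply: eq_bigr => i _.
by rewrite !mxE -natrM mulnb /= in_setI.
Qed.

(** * Tensors of partitions *)

(** A partition is encoded by the map [c] that sends an index to the label of
    its class; labels outside the range of [c] stand for empty classes. *)
Definition class_tensor (R : nzRingType) m n (J : finType) (c : 'I_n -> J) :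
    tensor R m n :=
  [ffun t : m.-tuple 'I_n => [exists j, all (mem (c @^-1: [set j])) t]%:R].
Arguments class_tensor R m {n J} c.

(** When [0 < m], the subscripts of an entry determine the only class that can
    contain them all, so at most one summand is nonzero there. For [m = 0]
    the sum would count the labels instead. *)
Lemma class_tensor_sum (R : nzRingType) m n (J : finType) (c : 'I_n -> J) :
  (0 < m)%N ->
  class_tensor R m c = \sum_j tensor_power m (indicator R (c @^-1: [set j])).
Proof.
move=> m0; apply/ffunP => t; rewrite sum_ffunE ffunE.
under eq_bigr => j _ do rewrite tensor_power_indicator.
pose k0 := c (tnth t (Ordinal m0)).
have only_k0 j : all (mem (c @^-1: [set j])) t -> j = k0.
  by move/all_tnthP/(_ (Ordinal m0)); rewrite /= !inE => /eqP.
rewrite (bigD1 k0) //= big1 => [|j jk0].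
  rewrite addr0; congr (nat_of_bool _)%:R; apply/existsP/idP => [[j tj]|].
    by rewrite -(only_k0 _ tj).
  by exists k0.
by case: (all _ _) (only_k0 j) jk0 => // /(_ isT)->; rewrite eqxx.
Qed.

(** Relabelling the classes does not change the partition. The condition
    [0 < m] excludes the case of an empty [J] and a nonempty [L], where the
    empty tuple would distinguish the two sides. *)
Lemma class_tensor_comp_inj (R : nzRingType) m n (J L : finType) (c : 'I_n -> J)
    (f : J -> L) :
  (0 < m)%N -> injective f -> class_tensor R m (f \o c) = class_tensor R m c.
Proof.
move=> m0 f_inj; apply/ffunP => t; rewrite !ffunE.
congr (nat_of_bool _)%:R; apply/existsP/existsP => [[l tl]|[j tj]].
  have lE : l = f (c (tnth t (Ordinal m0))).
    by move/all_tnthP/(_ (Ordinal m0)): tl; rewrite /= !inE => /eqP.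
  exists (c (tnth t (Ordinal m0))); apply: sub_all tl => x.
  by rewrite /= !inE lE /= (inj_eq f_inj).
by exists (f j); apply: sub_all tj => x; rewrite /= !inE /= (inj_eq f_inj).
Qed.

(** The map [c] is onto because conditions (2) and (3) both require the classes
    to be nonempty. *)
Definition partition_tensor (R : nzRingType) m n (A : tensor R m n) : Prop :=
  exists (q : nat) (c : 'I_n -> 'I_q),
    (forall j, exists i, c i = j) /\ A = class_tensor R m c.

(** Empty classes are discarded by relabelling with the image of [c]. *)
Lemma class_partition_tensor (R : nzRingType) m n (J : finType)
    (c : 'I_n -> J) :
  (0 < m)%N -> partition_tensor (class_tensor R m c).
Proof.
move=> m0; pose I := [set c x | x in 'I_n].
have cI x : c x \in I by apply: imset_f.
have [c' c'E] : exists c' : 'I_n -> 'I_#|I|, forall x, enum_val (c' x) = c x.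
  by exists (fun x => enum_rank_in (cI x) (c x)) => x; rewrite enum_rankK_in.
exists #|I|, c'; split=> [j|].
  have /imsetP[x _ jE] := enum_valP j.
  by exists x; apply: enum_val_inj; rewrite c'E jE.
rewrite -(class_tensor_comp_inj R c' m0 enum_val_inj).
apply/ffunP => t; rewrite !ffunE; congr (nat_of_bool _)%:R.
by apply: eq_existsb => j; apply: eq_all => x; rewrite /= !inE /= c'E.
Qed.

(** * From sums of powers to partitions *)

(** The principal subtensor on the singleton of [i] has the diagonal entry at
    [i] as its only entry. *)
Lemma no_zero_block_diag (R : nmodType) m n (A : tensor R m n) (i : 'I_n) :
  no_zero_block A -> A [tuple of nseq m i] != 0.
Proof.
move=> /(_ [set i]) nz; apply/eqP => Ai0.
apply: nz; first by apply/set0Pn; exists i; rewrite inE.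
apply/ffunP => t; rewrite !ffunE -[RHS]Ai0; congr (A _).
apply: eq_from_tnth => k; rewrite tnth_mktuple tnth_nseq.
exact/set1P/enum_valP.
Qed.

(** The diagonal entry at [i] is the number of supports that contain [i], so it
    must be 1. Characteristic zero enters here: elsewhere the entry would
    only determine that number modulo the characteristic. *)
Lemma CP_partition (R : numDomainType) m n (A : tensor R m n) :
  (0 < m)%N -> zero_one_tensor A -> no_zero_block A -> zero_one_CP A ->
  partition_tensor A.
Proof.
move=> m0 h01 nz [K [b [b01 AE]]].
pose V j := [set i | b j i 0 == 1].
have {AE} AE : A = \sum_(j < K) tensor_power m (indicator R (V j)).
  rewrite AE; apply: eq_bigr => j _.
  by rewrite [in LHS](zero_one_vectorE (b01 j)).
have diagE i : A [tuple of nseq m i] = #|[pred j | i \in V j]|%:R.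
  rewrite AE sum_ffunE -sum_natr_card; apply: eq_bigr => j _.
  by rewrite tensor_power_indicator all_nseq eqn0Ngt m0.
have uniqV : forall i, exists k, [pred j | i \in V j] =i pred1 k.
  move=> i; apply/card1P; have := no_zero_block_diag i nz.
  have /orP[->//|] := h01 [tuple of nseq m i].
  by rewrite diagE -[1]/(1%:R) eqr_nat.
have [c cE] := fin_all_exists uniqV.
have -> : A = class_tensor R m c; last exact: class_partition_tensor.
rewrite AE class_tensor_sum //; apply: eq_bigr => j _; congr tensor_power.
congr (indicator R _); apply/setP => i.
by have := cE i j; rewrite !inE => ->; rewrite eq_sym.
Qed.

(** * Partitions and unions of complete blocks *)

Lemma sum_card_fibers (T J : finType) (c : T -> J) :
  (\sum_j #|c @^-1: [set j]| = #|T|)%N.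
Proof.
rewrite -[RHS]sum1_card (partition_big c predT) //=.
apply: eq_bigr => j _; rewrite -sum1_card.
by apply: eq_bigl => x; rewrite !inE.
Qed.

(** Choose for each point a set [V j] that contains it. The fibres of this
    choice are contained in the [V j] and have the same total size, so the
    inclusions are equalities. *)
Lemma cover_fibers (T J : finType) (V : J -> {set T}) :
  \bigcup_j V j = [set: T] -> (\sum_j #|V j| = #|T|)%N ->
  exists c : T -> J, forall j, V j = c @^-1: [set j].
Proof.
move=> coverV sumV.
have inV : forall x, exists j, x \in V j.
  move=> x; have /bigcupP[j _ xj] : x \in \bigcup_j V j by rewrite coverV.
  by exists j.
have [c cV] := fin_all_exists inV; exists c.
have sub j : c @^-1: [set j] \subset V j.
  by apply/subsetP => x; rewrite !inE => /eqP <-.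
have := leqif_sum (fun j (_ : predT j) => subset_leqif_cards (sub j)).
case=> _; rewrite sum_card_fibers sumV eqxx => /esym/forallP eqV j.
by have /eqP := eqV j.
Qed.

(** Tuples with the same multiset of entries differ by a permutation of the
    positions, so for a symmetric tensor the witness of an edge can be any
    of its orderings. *)
Lemma edge_seq_mset (R : nzRingType) m n (A : tensor R m n)
    (t : m.-tuple 'I_n) :
  symmetric_tensor A ->
  (seq_mset t \in edges (associated_multihypergraph A)) = (A t == 1).
Proof.
move=> symA; apply/existsP/idP => [[u /andP[/eqP utE Au]]|At]; last first.
  by exists t; rewrite eqxx.
have /tuple_permP[p uE] : perm_eq u t by apply/eq_seq_msetP.
by rewrite -(symA p t) -(val_inj uE).
Qed.

Lemma perm_all_seq_mset n (P : pred 'I_n) (s : seq 'I_n) :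
  all P (seq_mset s) = all P s.
Proof. exact/perm_all/perm_eq_seq_mset. Qed.

Lemma size_seq_mset n (s : seq 'I_n) : size (seq_mset s) = size s.
Proof. exact/perm_size/perm_eq_seq_mset. Qed.

(** Membership of all subscripts in a class depends only on their multiset, and
    a multiset of size [m] is ordered into a tuple by enumerating it. *)
Lemma edges_class_tensor (R : nzRingType) m n (J : finType) (c : 'I_n -> J)
    (e : {mset 'I_n}%mset) :
  (e \in edges (associated_multihypergraph (class_tensor R m c))) =
  [exists j, (size e == m) && all (mem (c @^-1: [set j])) e].
Proof.
have natr_eq1 (x : bool) : (x%:R == 1 :> R) = x.
  by case: x; rewrite ?eqxx // eq_sym oner_eq0.
apply/existsP/existsP => [[t]|[j /andP[/eqP sz ej]]].
  rewrite ffunE natr_eq1 => /andP[/eqP <- /existsP[j tj]].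
  by exists j; rewrite perm_all_seq_mset size_seq_mset size_tuple eqxx.
have szE : size e == m by apply/eqP.
exists (Tuple szE); rewrite seq_mset_id eqxx ffunE natr_eq1 /=.
by apply/existsP; exists j.
Qed.

Lemma partition_complete_blocks (R : nzRingType) m n (A : tensor R m n) :
  partition_tensor A ->
  exists (q : nat) (H : 'I_q -> multihypergraph n) (s : 'I_q -> nat),
    [/\ forall i, (0 < s i)%N,
        (\sum_(i < q) s i)%N = n,
        forall i, complete_block m (H i) (s i)
      & is_union (associated_multihypergraph A) H].
Proof.
move=> [q [c [c_surj ->]]].
pose H j : multihypergraph n :=
  {| vertices := c @^-1: [set j];
     edges := [pred e : {mset 'I_n}%mset |
       (size e == m) && all (mem (c @^-1: [set j])) e] |}.
exists q, H, (fun j => #|c @^-1: [set j]|); split=> //.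
- move=> j; have [i ij] := c_surj j.
  by apply/card_gt0P; exists i; rewrite !inE ij.
- by rewrite sum_card_fibers card_ord.
split=> [|e]; last by rewrite edges_class_tensor.
apply/esym/setP => i; rewrite in_setT; apply/bigcupP.
by exists (c i); rewrite ?inE /=.
Qed.

Lemma complete_blocks_partition (R : nzRingType) m n (A : tensor R m n) q
    (H : 'I_q -> multihypergraph n) (s : 'I_q -> nat) :
  (0 < m)%N -> symmetric_tensor A -> zero_one_tensor A ->
  (\sum_(i < q) s i)%N = n -> (forall i, complete_block m (H i) (s i)) ->
  is_union (associated_multihypergraph A) H ->
  partition_tensor A.
Proof.
move=> m0 symA h01 sum_s blockH [coverH edgesH].
have [|c cE] := @cover_fibers _ _ (fun j => vertices (H j)) (esym coverH).
  by rewrite card_ord -[RHS]sum_s; apply: eq_bigr => j _; case: (blockH j).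
have -> : A = class_tensor R m c; last exact: class_partition_tensor.
apply/ffunP => t; rewrite ffunE.
have <- : (A t == 1) = [exists j, all (mem (c @^-1: [set j])) t].
  rewrite -edge_seq_mset // edgesH; apply: eq_existsb => j.
  have [_ ->] := blockH j.
  by rewrite size_seq_mset size_tuple eqxx perm_all_seq_mset cE.
exact: zero_oneE.
Qed.

(** * From partitions to orthogonal decompositions *)

Lemma partition_orthogonal (R : nzRingType) m n (A : tensor R m n) :
  (0 < m)%N -> partition_tensor A ->
  exists (q : nat) (u : 'I_q -> 'cV[R]_n) (s : 'I_q -> nat),
    [/\ forall j, (0 < s j)%N /\ zero_one_vector (u j),
        (\sum_(j < q) s j)%N = n,
        A = \sum_(j < q) tensor_power m (u j)
      & (matrix_of_columns u)^T *m matrix_of_columns u =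
          diag_mx (\row_(j < q) (s j)%:R)].
Proof.
move=> m0 [q [c [c_surj ->]]].
exists q, (fun j => indicator R (c @^-1: [set j])).
exists (fun j => #|c @^-1: [set j]|).
split.
- move=> j; split; last exact: zero_one_indicator.
  by have [i ij] := c_surj j; apply/card_gt0P; exists i; rewrite !inE ij.
- by rewrite sum_card_fibers card_ord.
- exact: class_tensor_sum.
rewrite indicator_gram; apply/matrixP => j k; rewrite !mxE.
have [->|jk] := eqVneq j k; first by rewrite setIid.
rewrite mulr0n -preimsetI; have -> : [set j] :&: [set k] = set0.
  by apply/eqP; rewrite setI_eq0 disjoints1 inE.
by rewrite preimset0 cards0.
Qed.

(** * The equivalence *)

Theorem theorem3p6 (R : realFieldType) (m n : nat) (hm : (2 <= m)%N)
    (hn : (1 <= n)%N) (A : tensor R m n) (hsym : symmetric_tensor A)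
    (h01 : zero_one_tensor A) (hblock : no_zero_block A) :
  let cond1 := zero_one_CP A in
  let cond2 :=
    exists (q : nat) (H : 'I_q -> multihypergraph n) (s : 'I_q -> nat),
      [/\ forall i, (0 < s i)%N,
          (\sum_(i < q) s i)%N = n,
          forall i, complete_block m (H i) (s i)
        & is_union (associated_multihypergraph A) H] in
  let cond3 :=
    exists (q : nat) (u : 'I_q -> 'cV[R]_n) (s : 'I_q -> nat),
      [/\ forall j, (0 < s j)%N /\ zero_one_vector (u j),
          (\sum_(j < q) s j)%N = n,
          A = \sum_(j < q) tensor_power m (u j)
        & (matrix_of_columns u)^T *m matrix_of_columns u =
            diag_mx (\row_(j < q) (s j)%:R)] in
  (cond1 <-> cond2) /\ (cond2 <-> cond3).
Proof.
move=> cond1 cond2 cond3; have m0 : (0 < m)%N by exact: ltnW.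
have part1 : cond1 -> partition_tensor A by exact: CP_partition.
have part2 : cond2 -> partition_tensor A.
  move=> [q [H [s [_ sum_s blockH unionH]]]].
  exact: complete_blocks_partition sum_s blockH unionH.
have one3 : cond3 -> cond1.
  by move=> [q [u [s [u01 _ AE _]]]]; exists q, u; split=> // j; case: (u01 j).
have three_part : partition_tensor A -> cond3 by exact: partition_orthogonal.
have two_part : partition_tensor A -> cond2 by exact: partition_complete_blocks.
by split; split; auto.
Qed.
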